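(* Let $S$ be a Hausdorff semitopological semigroup, let $\mathcal{F}$ be an m-admissible subalgebra of $\mathcal{CB}(S)$, and let $\mathcal{R}=\{\mathcal{A}^{\mu}:\mu\in S^{\mathcal{F}}\}$ be the associated semigroup compactification of $S$ realized by filters. Let $\mathcal{A}\subseteq Z(\mathcal{F})$ be a pure filter such that $\overline{\mathcal{A}}$ is a left ideal of $\mathcal{R}$. Then the following statements are equivalent. (i) $\overline{\mathcal{A}}$ is a minimal left ideal of $\mathcal{R}$. (ii) For every $A\in Z(\mathcal{F})$, if $\overline{\mathcal{A}}\setminus\overline{A}\neq\emptyset$, then for each $B\in Z(\mathcal{F})$ with $\overline{S}\setminus\overline{A}\subseteq(\overline{B})^{\circ}$ there exists a finite nonempty set $F\subseteq S$ such that $\bigcup_{x\in F}\lambda_{x}^{-1}(B)\in\mathcal{A}$. (iii) For every $A\in Z(\mathcal{F})$, if $\overline{\mathcal{A}}\setminus\overline{A}\neq\emptyset$, then for each $B\in Z(\mathcal{F})$ with $\overline{S}\setminus\overline{A}\subseteq(\overline{B})^{\circ}$ there exist $C\in\mathcal{A}$ and a finite nonempty set $F\subseteq S$ such that $C\cap A\subseteq\bigcup_{x\in F}\lambda_{x}^{-1}(B)$.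
   Context: Setting. $\mathcal{CB}(S)$ is the $C^*$-algebra of bounded continuous complex-valued functions on the Hausdorff semitopological semigroup $S$ (sup norm). A subalgebra $\mathcal{F}\subseteq\mathcal{CB}(S)$ is m-admissible if it is norm-closed, closed under conjugation, contains the constants, is invariant under the translations $(L_sf)(t)=f(st)$ and $(R_sf)(t)=f(ts)$, and $\mathbf{T}_\mu f\in\mathcal{F}$ for all $f\in\mathcal{F}$, $\mu\in S^{\mathcal{F}}$; here $S^{\mathcal{F}}$ is the set of multiplicative means on $\mathcal{F}$ with the Gelfand (weak$^*$) topology and $(\mathbf{T}_\mu f)(s)=\mu(L_sf)$. $S^{\mathcal{F}}$ is a compact Hausdorff right topological semigroup under $(\mu\nu)(f)=\mu(\mathbf{T}_\nu f)$; $\varepsilon:S\to S^{\mathcal{F}}$, $\varepsilon(s)(f)=f(s)$, is a continuous homomorphism with dense image. Filters. For $f\in\mathcal{F}$, $Z(f)=f^{-1}(\{0\})$, and $Z(\mathcal{F})=\{Z(f):f\in\mathcal{F}\}$. A filter (z-filter) is a set $\mathcal{A}\subseteq Z(\mathcal{F})$ with $\emptyset\notin\mathcal{A}$, $S\in\mathcal{A}$, closed under finite intersections and under supersets in $Z(\mathcal{F})$. $\mathcal{F}S$ is the set of z-ultrafilters (maximal z-filters). For each $p\in\mathcal{F}S$ there is a unique $\mu\in S^{\mathcal{F}}$ with $\bigcap_{A\in p}\overline{\varepsilon(A)}=\{\mu\}$ (closures in $S^{\mathcal{F}}$), and each $\mu$ arises from some $p$. Put $p\sim q$ if $p,q$ give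 the same $\mu$, let $[p]$ be the equivalence class of $p$, $\widetilde p=\bigcap[p]$, and $\mathcal{A}^\mu=\widetilde p$ when $p$ gives $\mu$. Set $\mathcal{R}=\{\widetilde p:p\in\mathcal{F}S\}=\{\mathcal{A}^\mu:\mu\in S^{\mathcal{F}}\}$. The map $\mu\mapsto\mathcal{A}^\mu$ is a bijection $S^{\mathcal{F}}\to\mathcal{R}$, which is an isomorphism and homeomorphism; so $\mathcal{A}^\mu*\mathcal{A}^\nu=\mathcal{A}^{\mu\nu}$, and the topology of $\mathcal{R}$ has base $\{\mathcal{R}\setminus\overline{A}:A\in Z(\mathcal{F})\}$, where $\overline{A}=\{\widetilde p:p\in\mathcal{F}S,\ A\in p\}$ for $A\in Z(\mathcal{F})$; in particular $\overline{S}=\mathcal{R}$. $(\cdot)^\circ$ denotes interior in $\mathcal{R}$. For a filter $\mathcal{A}$, $\overline{\mathcal{A}}=\{\widetilde p:p\in\mathcal{F}S,\ \mathcal{A}\subseteq p\}\subseteq\mathcal{R}$. A filter $\mathcal{A}$ is pure if for every $p\in\mathcal{F}S$, $\mathcal{A}\subseteq p$ implies $\mathcal{A}\subseteq\widetilde p$. For $x\in S$, $\lambda_x:S\to S$ is $\lambda_x(t)=xt$ (so $\lambda_x^{-1}(Z(f))=Z(L_xf)\in Z(\mathcal{F})$; $Z(\mathcal{F})$ is closed under finite unions). *)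

(* Defs.v *)
From HB Require Import structures.
From mathcomp Require Import all_boot all_order all_algebra.
From mathcomp Require Import all_classical all_reals all_analysis.
From mathcomp Require Import complex.

Set Implicit Arguments.
Unset Strict Implicit.
Unset Printing Implicit Defensive.

Import Order.TTheory GRing.Theory Num.Theory.
Import numFieldNormedType.Exports.
Import ComplexField.Normc.

Local Open Scope classical_set_scope.
Local Open Scope ring_scope.
Local Open Scope complex_scope.

HB.instance Definition _ (R : realType) :=
  PseudoPointedMetric.copy R[i] (R[i])^o.
HB.instance Definition _ (R : realType) := GRing.ComAlgebra.copy R[i] (R[i])^o.
HB.instance Definition _ (R : realType) := Vector.copy R[i] (R[i])^o.
HB.instance Definition _ (R : realType) := NormedModule.copy R[i] (R[i])^o.

HB.mixin Record isSemitopological S & Semigroup S & Topological S := {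
  continuous_mull : forall x : S, continuous (fun t : S => (x * t)%g);
  continuous_mulr : forall x : S, continuous (fun t : S => (t * x)%g)
}.

#[short(type="semitopSemigroupType")]
HB.structure Definition SemitopSemigroup :=
  {S of Semigroup S & Topological S & isSemitopological S}.

Section BoundedContinuous.
Context (R : realType) (S : semitopSemigroupType).

Definition supnorm (f : S -> R[i]) : R := sup (range (fun s => normc (f s))).

Definition CB : set (S -> R[i]) :=
  [set f : S -> R[i] | continuous f /\ exists M : R, forall s, normc (f s) <= M].

Definition ltransl (s : S) (f : S -> R[i]) : S -> R[i] :=
  fun t => f (s * t)%g.

Definition rtransl (s : S) (f : S -> R[i]) : S -> R[i] :=
  fun t => f (t * s)%g.

Lemma supnorm_ub f s : CB f -> normc (f s) <= supnorm f.
Proof.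
move=> [_ [M fM]]; apply: (@ub_le_sup R); last by exists s.
by exists M => _ [t _ <-].
Qed.

Lemma supnorm_le (f : S -> R[i]) M :
  0 <= M -> (forall s, normc (f s) <= M) -> supnorm f <= M.
Proof.
move=> M0 fM; have [[s _]|S0] := pselect (exists s : S, True).
  apply: ge_sup; first by exists (normc (f s)), s.
  by move=> _ [t _ <-].
rewrite /supnorm sup_out // => -[[_ [t _ _]] _].
by apply: S0; exists t.
Qed.

Lemma supnorm_ge0 f : 0 <= supnorm f.
Proof.
have [fs|nfs] := pselect (has_sup (range (fun s => normc (f s)))).
  have [[_ [s _ _]] fub] := fs.
  apply: (@le_trans _ _ (normc (f s))); last by apply: ub_le_sup => //; exists s.
  by case: (f s) => a b; rewrite /= sqrtr_ge0.
by rewrite /supnorm sup_out.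
Qed.

End BoundedContinuous.

(* All the requirements of m-admissibility except the one that involves the
   means; these are needed first, as T_mu f is defined from mu (L_s f). *)
Record invariant_subalgebra (R : realType) (S : semitopSemigroupType) := {
  isa_carrier :> set (S -> R[i]);
  isa_CB : isa_carrier `<=` @CB R S;
  isa_cst : forall c : R[i], isa_carrier (fun=> c);
  isa_add : forall f g, isa_carrier f -> isa_carrier g ->
    isa_carrier (fun s => f s + g s);
  isa_mul : forall f g, isa_carrier f -> isa_carrier g ->
    isa_carrier (fun s => f s * g s);
  isa_conj : forall f, isa_carrier f -> isa_carrier (fun s => (f s)^*);
  isa_closed : forall f, CB f ->
    (forall e : R, 0 < e ->
      exists2 g, isa_carrier g & supnorm (fun s => f s - g s) < e) ->
    isa_carrier f;
  isa_ltransl : forall s f, isa_carrier f -> isa_carrier (ltransl s f);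
  isa_rtransl : forall s f, isa_carrier f -> isa_carrier (rtransl s f)
}.

Section Means.
Context (R : realType) (S : semitopSemigroupType).
Variable F : invariant_subalgebra R S.

Definition elt (f : S -> R[i]) (Ff : isa_carrier F f) : F := exist _ f (mem_set Ff).

Definition eval (f : F) : S -> R[i] := sval f.

Lemma evalP (f : F) : isa_carrier F (eval f).
Proof. exact: set_valP. Qed.

Lemma elt_inj (f g : F) : (forall s, eval f s = eval g s) -> f = g.
Proof. by move=> fg; apply: val_inj; apply/funext. Qed.

Definition celt (c : R[i]) : F := elt (isa_cst F c).

Definition addelt (f g : F) : F := elt (isa_add (evalP f) (evalP g)).

Definition mulelt (f g : F) : F := elt (isa_mul (evalP f) (evalP g)).

Definition ltranslelt (s : S) (f : F) : F := elt (isa_ltransl s (evalP f)).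

(* A mean is a linear functional mu with ||mu|| = mu 1 = 1.  Scalars act as
   constant functions. *)
Definition multiplicative_mean (mu : F -> R[i]) :=
  [/\ forall f g, mu (addelt f g) = mu f + mu g,
      forall c f, mu (mulelt (celt c) f) = c * mu f,
      forall f, normc (mu f) <= supnorm (eval f),
      mu (celt 1) = 1 &
      forall f g, mu (mulelt f g) = mu f * mu g].

(* The topology is the one induced by pointwise convergence on F, i.e. the
   weak* topology. *)
Definition spectrum : Type :=
  [set mu : {ptws F -> R[i]} | multiplicative_mean mu].
HB.instance Definition _ := Topological.on spectrum.

Definition mean_fun (mu : spectrum) : F -> R[i] := sval mu.

Lemma mean_funP (mu : spectrum) : multiplicative_mean (mean_fun mu).
Proof. exact: (set_valP mu). Qed.

Definition mkmean (mu : F -> R[i]) (mP : multiplicative_mean mu) : spectrum :=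
  exist _ (mu : {ptws F -> R[i]}) (mem_set mP).

Definition Top (mu : spectrum) (f : F) : S -> R[i] :=
  fun s => mean_fun mu (ltranslelt s f).

Lemma evaluation_mean (s : S) : multiplicative_mean (fun f => eval f s).
Proof. by split=> // f; apply: supnorm_ub; apply: isa_CB; exact: evalP. Qed.

Definition eps (s : S) : spectrum := mkmean (evaluation_mean s).

End Means.

Record m_admissible (R : realType) (S : semitopSemigroupType) := {
  madm_isa :> invariant_subalgebra R S;
  madm_Top : forall (mu : spectrum madm_isa) (f : madm_isa),
    isa_carrier madm_isa (Top mu f)
}.

Section Compactification.
Context (R : realType) (S : semitopSemigroupType).
Variable F : m_admissible R S.

Definition Topelt (mu : spectrum F) (f : F) : F := elt (madm_Top mu f).

Lemma mean_mul_subproof (mu nu : spectrum F) :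
  multiplicative_mean (fun f : F => mean_fun mu (Topelt nu f)).
Proof.
have [muD muZ mub mu1 muM] := mean_funP mu.
have [nuD nuZ nub nu1 nuM] := mean_funP nu.
split.
- move=> f g; rewrite -muD; congr mean_fun; apply: elt_inj => s /=.
  by rewrite /eval /= /Top -nuD; congr mean_fun; exact: elt_inj.
- move=> c f; rewrite -muZ; congr mean_fun; apply: elt_inj => s /=.
  by rewrite /eval /= /Top -nuZ; congr mean_fun; exact: elt_inj.
- move=> f; apply: (le_trans (mub _)); apply: supnorm_le.
    exact: supnorm_ge0.
  move=> s; apply: (le_trans (nub _)); apply: supnorm_le.
    exact: supnorm_ge0.
  by move=> t; apply: (@supnorm_ub _ _ (eval f)); apply: isa_CB; exact: evalP.
- rewrite -[RHS]mu1; congr mean_fun; apply: elt_inj => s /=.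
  by rewrite /eval /= /Top -[RHS]nu1; congr mean_fun; exact: elt_inj.
- move=> f g; rewrite -muM; congr mean_fun; apply: elt_inj => s /=.
  by rewrite /eval /= /Top -nuM; congr mean_fun; exact: elt_inj.
Qed.

Definition mean_mul (mu nu : spectrum F) : spectrum F :=
  mkmean (mean_mul_subproof mu nu).

Definition zset (f : S -> R[i]) : set S := f @^-1` [set 0].

Definition zsets : set (set S) := [set zset f | f in (F : set _)].

Lemma zsetsI A B : zsets A -> zsets B -> zsets (A `&` B).
Proof.
move=> [f Ff <-] [g Fg <-].
exists (fun s => f s * (f s)^* + g s * (g s)^*).
  by apply: isa_add; apply: isa_mul => //; apply: isa_conj.
rewrite predeqE => s; rewrite /zset /= -!normCK; split=> [/eqP|[-> ->]].
  rewrite paddr_eq0 ?exprn_ge0 // !expf_eq0 /= !normr_eq0.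
  by move=> /andP[/eqP ? /eqP ?].
by rewrite !normr0 expr0n addr0.
Qed.

Lemma zsetsU A B : zsets A -> zsets B -> zsets (A `|` B).
Proof.
move=> [f Ff <-] [g Fg <-]; exists (fun s => f s * g s); first exact: isa_mul.
rewrite predeqE => s; rewrite /zset /=; split=> [/eqP|[->|->]].
- by rewrite mulf_eq0 => /orP[/eqP ?|/eqP ?]; [left|right].
- by rewrite mul0r.
- by rewrite mulr0.
Qed.

Lemma zsets0 : zsets set0.
Proof.
exists (fun=> 1); first exact: isa_cst.
by rewrite predeqE => s; split=> //= /eqP; rewrite oner_eq0.
Qed.

Definition zfilter (p : set (set S)) :=
  [/\ p `<=` zsets, ~ p set0, p setT,
      forall A B, p A -> p B -> p (A `&` B) &
      forall A B, p A -> zsets B -> A `<=` B -> p B].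

Definition zultrafilter (p : set (set S)) :=
  zfilter p /\ forall q, zfilter q -> p `<=` q -> q = p.

Lemma zultrafilterU p A B : zultrafilter p -> zsets A -> zsets B ->
  p (A `|` B) -> p A \/ p B.
Proof.
move=> [[pZ p0 pT pI pS] pmax] ZA ZB pAB.
have key C : zsets C -> ~ p C -> exists2 P, p P & P `&` C = set0.
  move=> ZC npC; apply: contrapT => noP; apply: npC.
  pose q := [set D | zsets D /\ exists2 P, p P & P `&` C `<=` D].
  have pq : p `<=` q.
    by move=> D pD; split; [exact: pZ|exists D => // s []].
  have qF : zfilter q.
    split.
    - by move=> D [].
    - move=> [_ [P pP PC]]; apply: noP; exists P => //.
      by apply/seteqP; split=> // s /PC.
    - exact: (pq _ pT).
    - move=> D E [ZD [P pP PD]] [ZE [Q pQ QE]]; split; first exact: zsetsI.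
      exists (P `&` Q); first exact: pI.
      by move=> s [[Ps Qs] Cs]; split; [exact: PD|exact: QE].
    - move=> D E [ZD [P pP PD]] ZE DE; split=> //; exists P => //.
      exact: subset_trans DE.
  by rewrite -(pmax _ qF pq); split=> //; exists setT => // s [].
apply: contrapT => /not_orP[/(key _ ZA)[P pP PA] /(key _ ZB)[Q pQ QB]].
apply: p0; rewrite (_ : set0 = P `&` Q `&` (A `|` B)).
  by apply: (pI) => //; exact: (pI).
rewrite predeqE => s; split=> // -[[Ps Qs] [As|Bs]].
  by have : (P `&` A) s by []; rewrite PA.
by have : (Q `&` B) s by []; rewrite QB.
Qed.

Definition gives (p : set (set S)) (mu : spectrum F) :=
  \bigcap_(A in p) closure (@eps R S F @` A) = [set mu].

Definition zequiv (p q : set (set S)) := exists2 mu, gives p mu & gives q mu.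

Definition ztilde (p : set (set S)) : set (set S) :=
  \bigcap_(q in [set q | zultrafilter q /\ zequiv p q]) q.

(* The intersection of the class of all p that give mu; it is A^mu = ~p for
   any such p, see Amu_ztilde. *)
Definition Amu (mu : spectrum F) : set (set S) :=
  \bigcap_(q in [set q | zultrafilter q /\ gives q mu]) q.

Lemma Amu_ztilde p mu : gives p mu -> Amu mu = ztilde p.
Proof.
move=> pmu; rewrite /Amu /ztilde; congr bigcap.
rewrite predeqE => q; split=> -[qU qmu]; split=> //; first by exists mu.
have [nu] := qmu; rewrite {1}/gives pmu => munu.
suff -> : mu = nu by [].
have : [set nu] nu by [].
by rewrite -munu => /= ->.
Qed.

Definition Rspace : Type := range Amu.
HB.instance Definition _ := Choice.on Rspace.

Definition Rval (x : Rspace) : set (set S) := sval x.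

Definition toR (mu : spectrum F) : Rspace :=
  exist _ (Amu mu) (mem_set (imageP Amu (I : setT mu))).

Lemma ofR_subproof (x : Rspace) : {mu : spectrum F | Amu mu = Rval x}.
Proof.
by apply: cid; have [mu _ muE] := set_valP x; exists mu.
Qed.

(* A chosen preimage under mu |-> A^mu; the map is a bijection, so this is its
   inverse. *)
Definition ofR (x : Rspace) : spectrum F := sval (ofR_subproof x).

Definition Rmul (x y : Rspace) : Rspace := toR (mean_mul (ofR x) (ofR y)).

Definition zbar (A : set S) : set Rspace :=
  [set x | exists p, [/\ zultrafilter p, p A & Rval x = ztilde p]].

Lemma zbarU A B : zsets A -> zsets B -> zbar (A `|` B) = zbar A `|` zbar B.
Proof.
move=> ZA ZB; rewrite predeqE => x; split=> [[p [pU pAB xp]]|].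
  by have [pA|pB] := zultrafilterU pU ZA ZB pAB; [left|right]; exists p.
have ZAB := zsetsU ZA ZB.
by move=> [|] [p [pU pA xp]]; exists p; split=> //;
  have [[_ _ _ _ pS] _] := pU; apply: (pS _ _ pA).
Qed.

Lemma zbar0 : zbar set0 = set0.
Proof. by rewrite predeqE => x; split=> // -[p [[[]]]]. Qed.

Let Rbase (A : set S) : set Rspace := ~` zbar A.

Let Rbase_cover : \bigcup_(A in zsets) Rbase A = setT.
Proof.
rewrite predeqE => x; split=> // _; exists set0; first exact: zsets0.
by rewrite /Rbase zbar0.
Qed.

Let Rbase_join A B x : zsets A -> zsets B -> Rbase A x -> Rbase B x ->
  exists C, [/\ zsets C, Rbase C x & Rbase C `<=` Rbase A `&` Rbase B].
Proof.
move=> ZA ZB Ax Bx; exists (A `|` B); rewrite /Rbase zbarU // setCU.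
by split=> //; exact: zsetsU.
Qed.

HB.instance Definition _ :=
  isBaseTopological.Build Rspace Rbase_cover Rbase_join.

Definition fbar (A : set (set S)) : set Rspace :=
  [set x | exists p, [/\ zultrafilter p, A `<=` p & Rval x = ztilde p]].

Definition pure (A : set (set S)) :=
  forall p, zultrafilter p -> A `<=` p -> A `<=` ztilde p.

Definition left_ideal (L : set Rspace) :=
  L !=set0 /\ forall x y, L y -> L (Rmul x y).

Definition minimal_left_ideal (L : set Rspace) :=
  left_ideal L /\ forall K, left_ideal K -> K `<=` L -> K = L.

End Compactification.

Arguments zsets {R S} F.
Arguments zfilter {R S} F p.
Arguments zultrafilter {R S} F p.
Arguments gives {R S} F p mu.
Arguments zequiv {R S} F p q.
Arguments ztilde {R S} F p.
Arguments Rspace {R S} F.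
Arguments zbar {R S} F A.
Arguments fbar {R S} F A.
Arguments pure {R S} F A.

(* Main.v *)
(* Two facts replace the explicit use of the compactness of S^F.  First, a
   z-ultrafilter p gives mu iff f tends to mu f along p for every f in F, and
   the sublevel sets {u <= e}, for u >= 0 in F with mu u = 0, form a base
   of the traces on S of the neighbourhoods of mu.  Second, a z-filter extends
   to a z-ultrafilter, which gives some mean.
   (i) => (ii): if no finite union of translates x^-1 B belonged to A, the
   z-filter generated by A and the complements of the translates would lie in a
   z-ultrafilter giving some nu in the ideal; by minimality the orbit of nu
   leaves zbar Z, so by density x nu does for some x in S, and then x^-1 B is a
   neighbourhood of nu.
   (iii) => (i): if mu is in the ideal but not in the orbit of nu, some u >= 0 in
   F vanishes at mu and exceeds e on the orbit; then (iii) fails for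
   Z = {u >= e/2} and B = {u <= e/2} at any point of the orbit. *)
Require Import Defs.
From HB Require Import structures.
From mathcomp Require Import all_boot all_order all_algebra.
From mathcomp Require Import all_classical all_reals all_analysis.
From mathcomp Require Import complex.
From mathcomp Require Import lra.

Set Implicit Arguments.
Unset Strict Implicit.
Unset Printing Implicit Defensive.

Import Order.TTheory GRing.Theory Num.Theory.
Import numFieldNormedType.Exports.
Import ComplexField.Normc.

Local Open Scope classical_set_scope.
Local Open Scope ring_scope.
Local Open Scope complex_scope.

Local Notation Re := complex.Re.
Local Notation Im := complex.Im.
Local Notation eval := Defs.eval.

(** * The modulus of a complex number and its real and imaginary parts *)

Section ComplexModulus.
Variable R : realType.
Implicit Types z w : R[i].

Lemma normc_normE z : `|z| = (normc z)%:C.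
Proof. by case: z. Qed.

Lemma normc_ge0 z : 0 <= normc z.
Proof. by case: z => a b; rewrite /= sqrtr_ge0. Qed.

Lemma normc_real (a : R) : normc a%:C = `|a|.
Proof. by rewrite /= expr0n /= addr0 sqrtr_sqr. Qed.

Lemma sqr_normcE z : ((normc z) ^+ 2)%:C = z * z^*.
Proof. by rewrite rmorphXn /= -normc_normE sqr_normc. Qed.

Lemma normc_triangle z w : normc (z + w) <= normc z + normc w.
Proof. exact: le_normcD. Qed.

Lemma normcB z w : normc (z - w) = normc (w - z).
Proof. by rewrite -normcN opprB. Qed.

Lemma normc_Re z : `|Re z| <= normc z.
Proof. by rewrite -lecR -normc_normE normc_ge_Re. Qed.

Lemma normc_Im z : `|Im z| <= normc z.
Proof.
case: z => a b; have /= := normc_Re (b +i* a).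
by rewrite addrC.
Qed.

Lemma normc_le_ReIm z : normc z <= `|Re z| + `|Im z|.
Proof.
rewrite [X in normc X]complexE (le_trans (normc_triangle _ _))//.
by rewrite normcM !normc_real /= expr0n expr1n add0r sqrtr1 mul1r.
Qed.

Lemma normc_small_eq z w : (forall e : R, 0 < e -> normc (z - w) <= e) -> z = w.
Proof.
move=> zw; apply/eqP; rewrite -subr_eq0; apply/eqP/eq0_normc.
by apply/eqP; rewrite eq_le normc_ge0 andbT; apply/ler_addgt0Pl => e /zw; rewrite addr0.
Qed.

End ComplexModulus.

(** * The real-valued functions in the algebra and their closure under absolute value *)

Section RealPart.
Variables (R : realType) (S : semitopSemigroupType).
Variable F : invariant_subalgebra R S.
Implicit Types (f : S -> R[i]) (u v : S -> R).

Definition realF u := isa_carrier F (fun s => (u s)%:C).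

Lemma realF_cst (a : R) : realF (fun=> a).
Proof. exact: isa_cst. Qed.

Lemma realFD u v : realF u -> realF v -> realF (fun s => u s + v s).
Proof.
move=> Fu Fv; have := isa_add Fu Fv; rewrite /realF.
by under [in X in X -> _]eq_fun do rewrite -rmorphD.
Qed.

Lemma realFM u v : realF u -> realF v -> realF (fun s => u s * v s).
Proof.
move=> Fu Fv; have := isa_mul Fu Fv; rewrite /realF.
by under [in X in X -> _]eq_fun do rewrite -rmorphM.
Qed.

Lemma realFB u v : realF u -> realF v -> realF (fun s => u s - v s).
Proof.
move=> Fu Fv.
rewrite (_ : (fun s => _) = (fun s => u s + (-1) * v s)); last first.
  by apply/funext => s; rewrite mulN1r.
by apply: realFD => //; apply: realFM => //; exact: realF_cst.
Qed.

Lemma isa_subc f (c : R[i]) : isa_carrier F f -> isa_carrier F (fun s => f s - c).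
Proof. by move=> Ff; apply: isa_add => //; exact: isa_cst. Qed.

Lemma realF_sqr_normc f (c : R[i]) :
  isa_carrier F f -> realF (fun s => normc (f s - c) ^+ 2).
Proof.
move=> /isa_subc => /(_ c) Ff; rewrite /realF.
under eq_fun do rewrite sqr_normcE.
by apply: isa_mul => //; exact: isa_conj.
Qed.

Lemma realF_Re f : isa_carrier F f -> realF (fun s => Re (f s)).
Proof.
move=> Ff; rewrite /realF; under eq_fun do rewrite ReJ_add.
apply: isa_mul; last exact: isa_cst.
by apply: isa_add => //; exact: isa_conj.
Qed.

Lemma realF_Im f : isa_carrier F f -> realF (fun s => Im (f s)).
Proof.
move=> Ff; rewrite (_ : (fun s => _) = (fun s => Re ((- 'i%C) * f s))).
  by apply: realF_Re; apply: isa_mul => //; exact: isa_cst.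
apply/funext => s; by rewrite mulNr -mulrN mulrC ReiNIm raddfN opprK.
Qed.

Lemma realF_bounded u : realF u -> exists2 M : R, 0 < M & forall s, `|u s| <= M.
Proof.
move=> /isa_CB[_ [M uM]]; exists (Num.max M 1).
  by rewrite lt_max ltr01 orbT.
by move=> s; rewrite -normc_real le_max uM.
Qed.

(* The polynomials p_{n+1} = p_n + (t^2 - p_n^2)/2 increase to |t| uniformly on
   [-1, 1]; this replaces the Weierstrass theorem. *)
Fixpoint abs_approx (n : nat) (t : R) : R :=
  if n is m.+1 then abs_approx m t + (t ^+ 2 - abs_approx m t ^+ 2) * 2^-1 else 0.

(** With [d = a - p], the new error is [d * (1 - (a + p) / 2)], at most [d * (1 - d / 2)] because
    [d <= a + p]. *)
Lemma abs_approx_step (a p k : R) : 0 <= p <= a -> a <= 1 -> 0 <= k ->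
  (a - p) * (k + 2) <= 2 ->
  0 <= p + (a ^+ 2 - p ^+ 2) * 2^-1 <= a /\
  (a - (p + (a ^+ 2 - p ^+ 2) * 2^-1)) * (k + 3) <= 2.
Proof.
move=> /andP[p0 pa] a1 k0 dk.
have h1 : 0 <= (a - p) * (a + p) by apply: mulr_ge0; lra.
have h2 : 0 <= (a - p) * (2 - a - p) by apply: mulr_ge0; lra.
split; first by apply/andP; split; nra.
set d := a - p in dk *.
have d0 : 0 <= d by rewrite subr_ge0.
have d1 : d <= 1 by rewrite /d; lra.
have dle : a - (p + (a ^+ 2 - p ^+ 2) * 2^-1) <= d * (1 - d * 2^-1).
  have : 0 <= (a - p) * p by apply: mulr_ge0; lra.
  rewrite /d; nra.
have k3 : 0 <= k + 3 by lra.
apply: le_trans (ler_wpM2r k3 dle) _.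
(* In the first case the factor [1 - d / 2 <= 1] is enough. In the second,
   [d ^+ 2 * (k + 3) / 2 >= d], so at most [d * (k + 2) <= 2] remains. *)
have [dk3|dk3] := leP (d * (k + 3)) 2.
  apply: le_trans dk3; rewrite -mulrA mulrCA ler_piMl//.
    by rewrite mulr_ge0.
  lra.
have h3 : 0 <= (2 - d * (k + 2)) * (k + 1) by apply: mulr_ge0; lra.
have h4 : 0 <= d * (d * (k + 3) - 2) by apply: mulr_ge0; lra.
nra.
Qed.

Lemma abs_approxP n (t : R) : `|t| <= 1 ->
  0 <= abs_approx n t <= `|t| /\ (`|t| - abs_approx n t) * (n%:R + 2) <= 2.
Proof.
move=> t1; have t0 : 0 <= `|t| by [].
elim: n => [|n [pt dn]] /=.
  by rewrite lexx t0 subr0 add0r ler_piMl.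
rewrite -(real_normK (num_real t)).
have [? dn'] := abs_approx_step pt t1 (ler0n _ n) dn; split=> //.
by rewrite (_ : n.+1%:R + 2 = n%:R + 3 :> R)// -[n.+1]addn1 natrD; lra.
Qed.

Lemma realF_abs_approx n u : realF u -> realF (fun s => abs_approx n (u s)).
Proof.
move=> Fu; elim: n => [|n IH] /=; first exact: realF_cst.
apply: realFD => //; apply: realFM; last exact: realF_cst.
by apply: realFB; under eq_fun do rewrite expr2; exact: realFM.
Qed.

(** Dividing by a bound [M] brings [u] into [-1, 1], where [M * abs_approx n] is within
    [2 * M / (n + 2)] of [|u|]; the algebra is norm-closed. *)
Lemma realF_abs u : realF u -> realF (fun s => `|u s|).
Proof.
move=> Fu; have [M M0 uM] := realF_bounded Fu.
pose v s := M^-1 * u s.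
have Fv : realF v by apply: realFM => //; exact: realF_cst.
have v1 s : `|v s| <= 1.
  by rewrite normrM gtr0_norm ?invr_gt0// mulrC ler_pdivrMr// mul1r.
have uv s : `|u s| = M * `|v s|.
  by rewrite normrM (gtr0_norm (_ : 0 < M^-1)) ?invr_gt0// mulrA divff ?mul1r// gt_eqF.
apply: isa_closed.
  split; last by exists M => s; rewrite normc_real normr_id.
  have [cu _] := isa_CB Fu; move=> s.
  rewrite (_ : (fun s => _) = (fun s => `|(u s)%:C|)); last first.
    by apply/funext => t; rewrite normc_normE normc_real.
  exact: (@cvg_norm _ _ _ _ _ (fun s => (u s)%:C) _ (cu s)).
move=> e e0.
have [n ne] : exists n : nat, 2 * M < e * (n%:R + 2).
  exists (Num.bound (2 * M / e)); rewrite [ltRHS]mulrC -ltr_pdivrMr//.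
  have Me0 : 0 <= 2 * M / e by rewrite divr_ge0 ?mulr_ge0 ?ltW.
  by apply: (lt_trans (archi_boundP Me0)); rewrite ltrDl.
exists (fun s => (M * abs_approx n (v s))%:C).
  by apply: realFM; [exact: realF_cst|exact: realF_abs_approx].
apply: (@le_lt_trans _ _ (2 * M / (n%:R + 2))); last first.
  by rewrite ltr_pdivrMr// ltr_wpDl.
apply: supnorm_le; first by rewrite divr_ge0 ?mulr_ge0 ?ltW.
move=> s; rewrite -rmorphB normc_real uv -mulrBr.
have [/andP[p0 pt] d] := abs_approxP n (v1 s).
rewrite ger0_norm; last by rewrite mulr_ge0 ?subr_ge0// ltW.
by rewrite ler_pdivlMr ?ltr_wpDl// -mulrA [2 * M]mulrC ler_pM2l.
Qed.

End RealPart.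

(** * Zero sets, extension to z-ultrafilters, and limits along them *)

Section ZeroSets.
Variables (R : realType) (S : semitopSemigroupType) (F : m_admissible R S).
Implicit Types (f : S -> R[i]) (u v : S -> R) (p q : set (set S)).

Lemma zsets_le u (e : R) : realF F u -> zsets F [set s | u s <= e].
Proof.
move=> Fu; have Fv := realFB Fu (realF_cst F e).
(* This is twice the positive part of [u - e]. *)
exists (fun s => (`|u s - e| + (u s - e))%:C).
  by apply: realFD => //; exact: realF_abs.
rewrite predeqE => s; rewrite /zset /=; split=> [/complexI h|h].
  by have := normr_ge0 (u s - e); lra.
by rewrite ler0_norm ?subr_le0// addNr.
Qed.

Lemma zsets_ge u (e : R) : realF F u -> zsets F [set s | e <= u s].
Proof.
move=> Fu; have := zsets_le (- e) (realFB (realF_cst F 0) Fu).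
by congr zsets; apply/seteqP; split=> s /=; rewrite sub0r lerN2.
Qed.

Lemma normc_ball_sqr f c (e : R) : 0 <= e ->
  [set s | normc (f s - c) <= e] = [set s | normc (f s - c) ^+ 2 <= e ^+ 2].
Proof.
by move=> e0; apply/seteqP; split=> s /=; rewrite ler_sqr ?nnegrE ?normc_ge0.
Qed.

Lemma zsets_normc_ball f c (e : R) : isa_carrier F f -> 0 <= e ->
  zsets F [set s | normc (f s - c) <= e].
Proof.
by move=> Ff e0; rewrite normc_ball_sqr//; apply: zsets_le; exact: realF_sqr_normc.
Qed.

Lemma zsetsT : zsets F setT.
Proof.
exists (fun=> 0); first exact: isa_cst.
by apply/seteqP; split=> // s.
Qed.

Lemma zfilter_nonempty p A : zfilter F p -> p A -> exists s, A s.
Proof.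
move=> [_ p0 _ _ _] pA; apply: contrapT => nA; apply: p0.
by rewrite -(_ : A = set0)//; apply/seteqP; split=> // s As; apply: nA; exists s.
Qed.

Lemma zfilter_sub_zultrafilter q : zfilter F q ->
  exists2 p, zultrafilter F p & q `<=` p.
Proof.
move=> qF; have [qZ q0 qT qI qS] := qF.
(* Joining [q] to [X] lets the empty chain, whose union is empty, satisfy the hypothesis of Zorn's
   lemma. *)
pose P (X : set (set S)) := zfilter F (q `|` X).
have [|X [PX Xmax]] := @Zorn_bigcup _ P.
  move=> C CP Ctot; rewrite /P.
  have CF X : C X -> zfilter F (q `|` X) by move=> /CP.
  have both A B : (q `|` \bigcup_(X in C) X) A -> (q `|` \bigcup_(X in C) X) B ->
      exists X, [/\ zfilter F (q `|` X), (q `|` X) A, (q `|` X) B &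
                    q `|` X `<=` q `|` \bigcup_(X in C) X].
    have sub X : C X -> q `|` X `<=` q `|` \bigcup_(X in C) X.
      by move=> CX D [qD|XD]; [left|right; exists X].
    move=> [qA|[X CX XA]] [qB|[Y CY YB]].
    - exists set0; rewrite setU0; split=> // D; by left.
    - by exists Y; split; [exact: CF|left|right|exact: sub].
    - by exists X; split; [exact: CF|right|left|exact: sub].
    - have [XY|YX] := Ctot _ _ CX CY.
        by exists Y; split; [exact: CF|right; exact: XY|right|exact: sub].
      by exists X; split; [exact: CF|right|right; exact: YX|exact: sub].
  split.
  - by move=> A /[dup] h /(both _ _ h)[X [[XZ _ _ _ _] XA _ _]]; exact: XZ.
  - by move=> /[dup] h /(both _ _ h)[X [[_ X0 _ _ _] XA _ _]]; exact: X0.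
  - by left.
  - move=> A B hA hB; have [X [[_ _ _ XI _] XA XB sub]] := both _ _ hA hB.
    by apply: sub; exact: XI.
  - move=> A B /[dup] h /(both _ _ h)[X [[_ _ _ _ XS] XA _ sub]] ZB AB.
    by apply: sub; exact: (XS A).
exists (q `|` X); last by move=> A; left.
split=> // r rF qXr; apply: contrapT => nr.
have Xr : X `<=` r by move=> A XA; apply: qXr; right.
apply: (Xmax r).
  split=> // rX; apply: nr; apply/seteqP; split=> // A rA; right; exact: rX.
rewrite /P (_ : q `|` r = r)//; apply/seteqP; split=> [A [qA|//]|A rA]; last by right.
by apply: qXr; left.
Qed.

(** Convergence of [f] to [c] along [p], tested on closed balls because their preimages are zero
    sets and so can belong to [p]. *)
Definition tends p f (c : R[i]) :=
  forall e : R, 0 < e -> p [set s | normc (f s - c) <= e].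

(** A z-filter contains zero sets only; the filter it generates on all subsets of [S] makes the
    general limit theorems applicable. *)
Definition zbase p : set_system S := filter_from p id.

Lemma zbase_filter p : zfilter F p -> ProperFilter (zbase p).
Proof.
move=> pF; have [_ _ pT pI _] := pF; apply: filter_from_proper.
  apply: filter_from_filter; first by exists setT.
  by move=> A B pA pB; exists (A `&` B) => //; exact: pI.
by move=> A /(zfilter_nonempty pF).
Qed.

Lemma tends_cvg p f c : zfilter F p -> tends p f c -> f @ zbase p --> c.
Proof.
move=> /zbase_filter pF pf; apply/cvgrPdist_le => /= e.
rewrite ltcE /= => /andP[/eqP e'0 e0].
exists [set s | normc (f s - c) <= Re e]; first exact: pf.
by move=> s /=; rewrite -lecR -normc_normE distrC; case: e {e0} e'0 => a b /= ->.
Qed.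

Lemma tends_unique p f c d : zfilter F p -> tends p f c -> tends p f d -> c = d.
Proof.
move=> /[dup] /zbase_filter pF pF' /tends_cvg fc /tends_cvg fd.
exact: (cvg_unique (@norm_hausdorff _ _) (fc pF') (fd pF')).
Qed.

(** The sum is assumed to have a limit, as members of the algebra do along a z-ultrafilter;
    uniqueness of limits then identifies it. *)
Lemma tendsD p f g c d : zfilter F p -> tends p f c -> tends p g d ->
  forall x, tends p (fun s => f s + g s) x -> x = c + d.
Proof.
move=> /[dup] /zbase_filter pF pF' fc gd x fgx.
apply: (cvg_unique (@norm_hausdorff _ _) (tends_cvg pF' fgx)).
by apply: cvgD; exact: tends_cvg.
Qed.

Lemma tendsM p f g c d : zfilter F p -> tends p f c -> tends p g d ->
  forall x, tends p (fun s => f s * g s) x -> x = c * d.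
Proof.
move=> /[dup] /zbase_filter pF pF' fc gd x fgx.
apply: (cvg_unique (@norm_hausdorff _ _) (tends_cvg pF' fgx)).
by apply: cvgM; exact: tends_cvg.
Qed.

Lemma tends_cst p (c : R[i]) : zfilter F p -> tends p (fun=> c) c.
Proof.
move=> [_ _ pT _ pS] e e0; rewrite (_ : [set _ | _] = setT)//.
by apply/seteqP; split=> // s _ /=; rewrite subrr normc0 ltW.
Qed.

(** The limit is the supremum of the [a] with [{a <= u}] in [p]. For [b] above it, [{u <= b}] and
    [{b <= u}] cover [S], so primeness puts the former in [p]. *)
Lemma zultrafilter_tends_real p u : zultrafilter F p -> realF F u ->
  exists a : R, tends p (fun s => (u s)%:C) a%:C.
Proof.
move=> pU Fu; have [pF _] := pU; have [_ _ pT pI pS] := pF.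
have [M M0 uM] := realF_bounded Fu.
pose A := [set a : R | p [set s | a <= u s]].
have AM a : A a -> a <= M.
  move=> /(zfilter_nonempty pF)[s /= /le_trans]; apply.
  exact: le_trans (ler_norm _) (uM s).
have A0 : A (- M).
  rewrite /A /= (_ : [set _ | _] = setT)//; apply/seteqP; split=> // s _ /=.
  by have := uM s; rewrite ler_norml => /andP[].
have supA : has_sup A by split; [exists (- M)|exists M => a /AM].
exists (sup A) => e e0.
have [a Aa aA] := sup_adherent e0 supA.
have nA : ~ A (sup A + e).
  by move=> /(ub_le_sup supA.2); rewrite leNgt ltrDl e0.
have Zle : p [set s | u s <= sup A + e].
  have := zultrafilterU pU (zsets_le (sup A + e) Fu) (zsets_ge (sup A + e) Fu).
  rewrite (_ : _ `|` _ = setT); first by case.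
  by apply/seteqP; split=> // s _ /=; apply/orP; exact: le_total.
apply: (pS _ _ (pI _ _ Aa Zle)).
  by apply: zsets_normc_ball => //; rewrite ltW.
move=> s []; rewrite /mkset => au uA.
rewrite -rmorphB normc_real ler_norml; lra.
Qed.

Lemma zultrafilter_tends p f : zultrafilter F p -> isa_carrier F f ->
  exists c, tends p f c.
Proof.
move=> pU Ff; have [[_ _ pT pI pS] _] := pU.
have [a pa] := zultrafilter_tends_real pU (realF_Re Ff).
have [b pb] := zultrafilter_tends_real pU (realF_Im Ff).
exists (a +i* b) => e e0; have e2 : 0 < e / 2 by rewrite divr_gt0.
apply: (pS _ _ (pI _ _ (pa _ e2) (pb _ e2))).
  by apply: zsets_normc_ball => //; rewrite ltW.
move=> s []; rewrite /mkset -!rmorphB !normc_real => ha hb.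
apply: (le_trans (normc_le_ReIm _)); rewrite !raddfB /=; lra.
Qed.

End ZeroSets.

(** * The correspondence between means and z-ultrafilters, and the points of R *)

Section MeansAndZultrafilters.
Variables (R : realType) (S : semitopSemigroupType) (F : m_admissible R S).
Implicit Types (f : F) (u v : S -> R) (p q : set (set S)) (mu nu : spectrum F).

Lemma spectrum_ext mu nu : (forall f, mean_fun mu f = mean_fun nu f) -> mu = nu.
Proof. by move=> munu; apply: val_inj; apply/funext. Qed.

Lemma mean_fun_continuous f : continuous (fun mu => mean_fun mu f).
Proof.
move=> mu; apply: (@continuous_comp (spectrum F) {ptws F -> R[i]} R[i] set_val (proj f)).
  exact: initial_continuous.
exact: proj_continuous.
Qed.

Lemma tends_eps_cvg p mu : zfilter F p ->
  (forall f, tends p (eval f) (mean_fun mu f)) -> @eps R S F @ zbase p --> mu.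
Proof.
move=> pF pmu; have zF := zbase_filter pF.
have pcvg : (fun s => set_val (eps F s) : {ptws F -> R[i]}) @ zbase p --> set_val mu.
  apply/cvg_sup => f N /= [_ [[W oW <-] Wmu] sub].
  have Wn : nbhs (mean_fun mu f) W by exact: open_nbhs_nbhs.
  have := tends_cvg pF (pmu f) Wn; rewrite !nbhs_simpl /=.
  by apply: filterS => s Ws; exact: sub.
move=> N /= [_ [[W oW <-] Wmu] sub].
have Wn : nbhs (set_val mu) W by exact: open_nbhs_nbhs.
have := pcvg _ Wn; rewrite !nbhs_simpl /=.
by apply: filterS => s Ws; exact: sub.
Qed.

(** A mean in all the closures is within every [e] of [mu] at each [f], by the closure of a small
    ball around [mu f]. Conversely [eps] converges to [mu] along [p], so [mu] lies in every
    closure. *)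
Lemma tends_gives p mu : zfilter F p ->
  (forall f, tends p (eval f) (mean_fun mu f)) -> gives F p mu.
Proof.
move=> pF pmu; have [_ _ _ pI _] := pF; rewrite /gives predeqE => nu; split=> [clnu|->].
  apply: spectrum_ext => f; apply: normc_small_eq => e e0.
  have e2 : 0 < e / 2 by rewrite divr_gt0.
  have e2C : 0 < (e / 2)%:C :> R[i] by rewrite ltcR.
  have := @mean_fun_continuous f nu.
  move=> /cvgrPdist_lt/(_ _ e2C)/(clnu _ (pmu f _ e2))[_ [[s /= fs <-]]].
  rewrite normc_normE ltcR => nus.
  rewrite -(subrK (eval f s) (mean_fun nu f)) -addrA.
  apply: (le_trans (normc_triangle _ _)).
  move: nus; rewrite /mean_fun /= => nus; move: fs nus; rewrite -/(mean_fun nu f); lra.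
move=> A pA N /(tends_eps_cvg pF pmu); rewrite nbhs_simpl /= => -[B pB BN].
have [s [As Bs]] := zfilter_nonempty pF (pI _ _ pA pB).
by exists (eps F s); split; [exists s|exact: BN].
Qed.

Lemma gives_inj p mu nu : gives F p mu -> gives F p nu -> mu = nu.
Proof.
rewrite /gives => -> munu; have : [set mu] mu by [].
by rewrite munu.
Qed.

Lemma zultrafilter_mean p : zultrafilter F p ->
  exists mu, forall f, tends p (eval f) (mean_fun mu f).
Proof.
move=> pU; have [pF _] := pU.
(* The default 0 is never taken: every [f] has a limit along [p]. *)
pose m f := xget 0 (tends p (eval f)).
have mP f : tends p (eval f) (m f).
  by have [c pc] := zultrafilter_tends pU (evalP f); exact: xgetI pc.
have mM : multiplicative_mean m.
  split.
  - by move=> f g; exact: (tendsD pF (mP f) (mP g) (mP (addelt f g))).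
  - move=> c f; apply: (tendsM pF _ (mP f) (mP (mulelt (celt F c) f))).
    exact: (tends_cst c pF).
  - move=> f; apply/ler_addgt0Pr => e e0.
    have [s /= fs] := zfilter_nonempty pF (mP f _ e0).
    rewrite -(subrK (eval f s) (m f)); apply: (le_trans (normc_triangle _ _)).
    rewrite addrC lerD//; last by rewrite normcB.
    by apply: supnorm_ub; apply: isa_CB; exact: evalP.
  - apply: (tends_unique pF (mP _)); exact: (tends_cst 1 pF).
  - by move=> f g; exact: (tendsM pF (mP f) (mP g) (mP (mulelt f g))).
by exists (mkmean mM).
Qed.

Lemma gives_tends p mu : zultrafilter F p -> gives F p mu ->
  forall f, tends p (eval f) (mean_fun mu f).
Proof.
move=> pU pmu; have [nu pnu] := zultrafilter_mean pU.
by rewrite (gives_inj pmu (tends_gives pU.1 pnu)).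
Qed.

(* The sublevel sets {u <= e} of these u are a base of the traces on S of the
   neighbourhoods of mu. *)
Definition mean_null mu u :=
  (exists Fu : realF F u, mean_fun mu (elt Fu) = 0) /\ forall s, 0 <= u s.

Lemma mean_nullD mu u v : mean_null mu u -> mean_null mu v ->
  mean_null mu (fun s => u s + v s).
Proof.
move=> [[Fu muu] u0] [[Fv muv] v0]; split; last by move=> s; rewrite addr_ge0.
exists (realFD Fu Fv).
have [muD _ _ _ _] := mean_funP mu.
rewrite -[RHS]addr0 -{1}muu -{1}muv -muD; congr mean_fun.
by apply: elt_inj => s; rewrite /eval /= -rmorphD.
Qed.

(** The function is the product of [f - mu f] and its conjugate, and [mu] is multiplicative and
    vanishes on the first factor. *)
Lemma mean_null_sqr mu f :
  mean_null mu (fun s => normc (eval f s - mean_fun mu f) ^+ 2).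
Proof.
split; last by move=> s; exact: sqr_ge0.
exists (realF_sqr_normc (mean_fun mu f) (evalP f)).
have [muD muZ _ mu1 muM] := mean_funP mu.
pose g := addelt f (mulelt (celt F (- mean_fun mu f)) (celt F 1)).
have g0 : mean_fun mu g = 0 by rewrite /g muD muZ mu1 mulr1 subrr.
rewrite -[RHS](mul0r (mean_fun mu (elt (isa_conj (evalP g))))) -{1}g0 -muM.
by congr mean_fun; apply: elt_inj => s; rewrite /eval /= -sqr_normcE mulr1.
Qed.

(** If [u > e] everywhere and [u <= M], then [1 - u / M] has norm at most [1 - e / M < 1], whereas
    [mu] takes the value 1 on it. *)
Lemma mean_null_nonempty mu u (e : R) : mean_null mu u -> 0 < e ->
  exists s, u s <= e.
Proof.
move=> [[Fu muu] u0] e0; apply: contrapT => nu.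
have ue s : e < u s by rewrite ltNge; apply/negP => ?; apply: nu; exists s.
have [M0 M00 uM0] := realF_bounded Fu.
(* The maximum with [e] makes [1 - e / M] nonnegative, as [supnorm_le] requires. *)
pose M := Num.max M0 e.
have M_gt0 : 0 < M by rewrite lt_max M00.
have uM s : u s <= M by rewrite le_max (le_trans (ler_norm _) (uM0 s)).
have eM : e <= M by rewrite le_max lexx orbT.
have [muD muZ mub mu1 _] := mean_funP mu.
have := mub (addelt (celt F 1) (mulelt (celt F (- M^-1)%:C) (elt Fu))).
rewrite muD muZ muu mu1 mulr0 addr0 normc1 leNgt => /negP; apply.
apply: (@le_lt_trans _ _ (1 - e / M)); last by rewrite ltrBlDr ltrDl divr_gt0.
apply: supnorm_le; first by rewrite subr_ge0 ler_pdivrMr// mul1r.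
move=> s; rewrite /eval [X in normc X](_ : _ = (1 - u s / M)%:C); last first.
  by rewrite /= rmorphB rmorphM rmorphN mulNr mulrC.
have /ltW := ue s; have := uM s; have := u0 s.
rewrite normc_real -(ler_pM2r M_gt0) => us0 usM use.
have uM1 : u s / M <= 1 by rewrite ler_pdivrMr// mul1r.
by rewrite ger0_norm ?subr_ge0// lerB// ler_pM2r// invr_gt0.
Qed.

Lemma gives_mean_null p mu u (e : R) : zultrafilter F p -> gives F p mu ->
  mean_null mu u -> 0 < e -> p [set s | u s <= e].
Proof.
move=> pU pmu [[Fu muu] u0] e0; have [[_ _ _ _ pS] _] := pU.
apply: (pS _ _ (gives_tends pU pmu (elt Fu) e0)); first exact: zsets_le.
by move=> s; rewrite /mkset muu subr0 normc_real ger0_norm.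
Qed.

Lemma mean_null_gives p mu : zultrafilter F p ->
  (forall u (e : R), mean_null mu u -> 0 < e -> p [set s | u s <= e]) ->
  gives F p mu.
Proof.
move=> [pF _] pmu; apply: tends_gives => // f e e0.
rewrite normc_ball_sqr ?ltW//; apply: pmu; first exact: mean_null_sqr.
by rewrite exprn_gt0.
Qed.

(** The sublevel sets that are basic at [mu] all meet [Z], so together with [Z] they generate a
    z-filter; a z-ultrafilter above it contains them all and hence gives [mu]. *)
Lemma zultrafilter_at mu Z : zsets F Z ->
  (forall u (e : R), mean_null mu u -> 0 < e -> exists s, u s <= e /\ Z s) ->
  exists p, [/\ zultrafilter F p, p Z & gives F p mu].
Proof.
move=> ZZ Zmu.
have [w mu_w] : exists w, mean_null mu w.
  by eexists; exact: (mean_null_sqr mu (celt F 0)).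
pose q := [set A | zsets F A /\ exists u (e : R), [/\ mean_null mu u, 0 < e &
  [set s | u s <= e] `&` Z `<=` A]].
have qF : zfilter F q.
  split.
  - by move=> A [].
  - by move=> [_ [u [e [mu_u e0 ue]]]]; have [s /ue] := Zmu _ _ mu_u e0.
  - by split; [exact: zsetsT|exists w, 1].
  - move=> A B [ZA [u [d [mu_u d0 uA]]]] [ZB [v [e [mu_v e0 vB]]]].
    split; first exact: zsetsI.
    (* By nonnegativity, [u + v <= min d e] forces both [u <= d] and [v <= e]. *)
    exists (fun s => u s + v s), (Num.min d e).
    split; [exact: mean_nullD|by rewrite lt_min d0|].
    have [_ u_ge0] := mu_u; have [_ v_ge0] := mu_v.
    move=> s [/=]; rewrite le_min => /andP[ud ve] Zs; have := u_ge0 s; have := v_ge0 s.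
    by split; [apply: uA|apply: vB]; split=> //=; lra.
  - move=> A B [ZA [u [e [mu_u e0 uA]]]] ZB AB; split=> //.
    by exists u, e; split=> //; exact: subset_trans AB.
have [p pU qp] := zfilter_sub_zultrafilter qF.
exists p; split=> //.
  by apply: qp; split=> //; exists w, 1; split=> // s [].
apply: mean_null_gives => // u e mu_u e0; apply: qp; split.
  by have [[Fu _] _] := mu_u; exact: zsets_le.
by exists u, e; split=> // s [].
Qed.

Lemma gives_ex mu : exists2 p, zultrafilter F p & gives F p mu.
Proof.
have [|p [pU _ pmu]] := zultrafilter_at (mu := mu) (zsetsT F); last by exists p.
by move=> u e /mean_null_nonempty/[apply] -[s us]; exists s.
Qed.

Lemma mean_null_sub_eq mu nu : (forall u, mean_null mu u -> mean_null nu u) ->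
  nu = mu.
Proof.
move=> munu; have [p pU pnu] := gives_ex nu.
apply: (gives_inj pnu); apply: mean_null_gives => // u e /munu.
exact: gives_mean_null.
Qed.

(** The value is a limit of values of [u] along a z-ultrafilter giving [mu]. *)
Lemma mean_ge0 mu u (Fu : realF F u) : (forall s, 0 <= u s) ->
  exists2 r : R, 0 <= r & mean_fun mu (elt Fu) = r%:C.
Proof.
move=> u0; have [p pU pmu] := gives_ex mu.
have near0 (e : R) : 0 < e -> exists s, normc ((u s)%:C - mean_fun mu (elt Fu)) <= e.
  by move=> e0; exact: (zfilter_nonempty pU.1 (gives_tends pU pmu (elt Fu) e0)).
case: (mean_fun mu (elt Fu)) near0 => a b near0.
have b0 : b = 0.
  apply/eqP; rewrite -normr_eq0 eq_le normr_ge0 andbT.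
  apply/ler_addgt0Pr => e /near0[s]; rewrite add0r.
  by apply: le_trans; rewrite -normrN -[- b]add0r; exact: (normc_Im ((u s)%:C - (a +i* b))).
exists a; last by rewrite b0.
apply/ler_addgt0Pr => e /near0[s us].
have := le_trans (normc_Re _) us; rewrite /= ler_norml; have := u0 s; lra.
Qed.

(** The sublevel sets basic at [mu] lie in every z-ultrafilter giving [mu], hence in
    [Amu mu = Amu nu]; so a z-ultrafilter giving [nu] contains them and gives [mu] too. *)
Lemma Amu_inj mu nu : Amu mu = Amu nu -> mu = nu.
Proof.
move=> munu; have [p pU pnu] := gives_ex nu.
apply: (gives_inj _ pnu); apply: mean_null_gives => // u e mu_u e0.
suff : Amu nu [set s | u s <= e] by move/(_ p (conj pU pnu)).
by rewrite -munu => q [qU qmu]; exact: gives_mean_null qmu mu_u e0.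
Qed.

Lemma toRK : cancel (@toR R S F) (@ofR R S F).
Proof. by move=> mu; apply: Amu_inj; rewrite /ofR; case: ofR_subproof. Qed.

Lemma ofRK : cancel (@ofR R S F) (@toR R S F).
Proof. by move=> x; apply: val_inj; rewrite /ofR; case: ofR_subproof. Qed.

Lemma ztilde_toR p mu : zultrafilter F p ->
  Rval (toR mu) = ztilde F p <-> gives F p mu.
Proof.
move=> pU; split=> [|pmu]; last by rewrite -(Amu_ztilde pmu).
have [nu pnu] := zultrafilter_mean pU; have {pnu} := tends_gives pU.1 pnu.
by move=> pnu; rewrite -(Amu_ztilde pnu) => /Amu_inj ->.
Qed.

Lemma zbarP Z mu : zbar F Z (toR mu) <-> exists p, [/\ zultrafilter F p, p Z & gives F p mu].
Proof.
by split=> -[p [pU pZ /(ztilde_toR _ pU) pmu]]; exists p.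
Qed.

Lemma fbarP A mu :
  fbar F A (toR mu) <-> exists p, [/\ zultrafilter F p, A `<=` p & gives F p mu].
Proof.
by split=> -[p [pU pZ /(ztilde_toR _ pU) pmu]]; exists p.
Qed.

Lemma zbarT : zbar F setT = setT.
Proof.
apply/seteqP; split=> // x _; rewrite -(ofRK x).
have [p pU pmu] := gives_ex (ofR x); apply/zbarP; exists p; split=> //.
by have [[_ _ ? _ _] _] := pU.
Qed.

Lemma not_zbar_mean_null Z mu : zsets F Z -> ~ zbar F Z (toR mu) ->
  exists u (e : R), [/\ mean_null mu u, 0 < e & forall s, u s <= e -> ~ Z s].
Proof.
move=> ZZ nZ; apply: contrapT => nue; apply: nZ; apply/zbarP.
apply: zultrafilter_at => // u e mu_u e0; apply: contrapT => nZ.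
by apply: nue; exists u, e; split=> // s us Zs; apply: nZ; exists s.
Qed.

(** If [Z] is the zero set of [f], then along a z-ultrafilter containing [Z] and giving [eps s], [f]
    vanishes on [Z] and tends to [f s]. *)
Lemma zbar_eps Z s : zsets F Z -> zbar F Z (toR (eps F s)) -> Z s.
Proof.
move=> [f Ff <-] /zbarP[p [pU pZ ps]]; have [[_ _ _ pI _] _] := pU.
rewrite /zset /=; apply: normc_small_eq => e e0.
have [t [/= ft0]] := zfilter_nonempty pU.1
  (pI _ _ pZ (gives_tends pU ps (elt Ff) e0)).
by rewrite /eval /= ft0 sub0r normcN subr0.
Qed.

Lemma open_zbarC Z : zsets F Z -> open (~` zbar F Z).
Proof.
move=> ZZ; exists [set Z]; first by move=> _ ->.
by rewrite bigcup_set1.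
Qed.

End MeansAndZultrafilters.

(** * Left ideals, orbits, and the two implications that involve minimality *)

Section Semigroup.
Variables (R : realType) (S : semitopSemigroupType) (F : m_admissible R S).
Implicit Types (f : F) (u v : S -> R) (p q : set (set S)) (mu nu rho : spectrum F).

Lemma mean_mulA mu nu rho :
  mean_mul (mean_mul mu nu) rho = mean_mul mu (mean_mul nu rho).
Proof.
apply: spectrum_ext => f; rewrite /mean_fun /=; congr (sval mu _).
apply: elt_inj => s; rewrite /eval /= /Top /mean_fun /=; congr (sval nu _).
apply: elt_inj => t; rewrite /eval /= /Top /ltransl /mean_fun /=; congr (sval rho _).
by apply: elt_inj => r; rewrite /eval /= /ltransl mulgA.
Qed.

Lemma Rmul_toR mu nu : Rmul (toR mu) (toR nu) = toR (mean_mul mu nu).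
Proof. by rewrite /Rmul !toRK. Qed.

Lemma left_ideal_orbit (x0 y : Rspace F) : left_ideal [set Rmul x y | x in setT].
Proof.
split; first by exists (Rmul x0 y), x0.
move=> x _ [z _ <-]; exists (Rmul x z) => //.
by rewrite -(ofRK x) -(ofRK y) -(ofRK z) !Rmul_toR mean_mulA.
Qed.

Lemma zsets_ltransl x B : zsets F B -> zsets F ((fun t => x * t)%g @^-1` B).
Proof. by move=> [f Ff <-]; exists (ltransl x f) => //; exact: isa_ltransl. Qed.

Lemma zsets_bigcup_finite (E : set S) (B : S -> set S) : finite_set E ->
  (forall x, zsets F (B x)) -> zsets F (\bigcup_(x in E) B x).
Proof.
move=> /finite_seqP[s ->] ZB; rewrite bigcup_seq.
by elim/big_ind : _ => [|X Y|x _]; [exact: zsets0|exact: zsetsU|exact: ZB].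
Qed.

Lemma zultrafilter_bigcup_finite p (E : set S) (B : S -> set S) :
  zultrafilter F p -> finite_set E -> (forall x, zsets F (B x)) ->
  p (\bigcup_(x in E) B x) -> exists2 x, E x & p (B x).
Proof.
move=> pU /finite_seqP[s ->] ZB.
elim: s => [|x s IH].
  by rewrite set_nil bigcup_set0; have [[_ ? _ _ _] _] := pU.
have Zs := zsets_bigcup_finite (finite_seq s) ZB.
rewrite bigcup_seq big_cons -bigcup_seq => /(zultrafilterU pU (ZB x) Zs)[].
  by exists x => //=; exact: mem_head.
by move=> /IH[y ys pBy]; exists y => //=; rewrite in_cons ys orbT.
Qed.

(** Pulls the hypothesis on [B] back to [S] along [eps]. *)
Lemma zbar_eps_setC Z B : zsets F Z -> zsets F B ->
  zbar F setT `\` zbar F Z `<=` (zbar F B)° -> ~` Z `<=` B.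
Proof.
move=> ZZ ZB ZBi s nZs; apply: (zbar_eps ZB); apply: interior_subset; apply: ZBi.
by split; [rewrite zbarT|move=> /(zbar_eps ZZ)].
Qed.

Lemma minimal_left_ideal_syndetic (A : set (set S)) Z B : zfilter F A ->
  minimal_left_ideal (fbar F A) -> zsets F Z -> fbar F A `\` zbar F Z !=set0 ->
  zsets F B -> zbar F setT `\` zbar F Z `<=` (zbar F B)° ->
  exists E : set S, [/\ finite_set E, E !=set0 &
    A (\bigcup_(x in E) ((fun t => x * t)%g @^-1` B))].
Proof.
move=> hA [[_ Aideal] Amin] ZZ [x0 [Ax0 nZx0]] ZB /(zbar_eps_setC ZZ ZB) nZB.
have [AZ A0 AT AI AS] := hA.
have [s0 _] := zfilter_nonempty hA AT.
pose U E := \bigcup_(x in E) ((fun t => x * t)%g @^-1` B).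
have ZU E : finite_set E -> zsets F (U E).
  by move=> Efin; apply: zsets_bigcup_finite => // x; exact: zsets_ltransl.
apply: contrapT => noE.
(* The complements of the unions [U E] need not be zero sets, so the z-filter they generate with [A]
   is described through its zero supersets. *)
pose q := [set Q | zsets F Q /\ exists D E, [/\ A D, finite_set E & D `\` U E `<=` Q]].
have qF : zfilter F q.
  split.
  - by move=> Q [].
  (* Adding [s0] keeps the set of translates nonempty even when [E] is empty. *)
  - move=> [_ [D [E [AD Efin DE]]]]; apply: noE; exists (s0 |` E).
    have fin0 : finite_set (s0 |` E) by rewrite finite_setU; split=> //; exact: finite_set1.
    split=> //; first by exists s0; left.
    apply: (AS _ _ AD); first exact: ZU.
    move=> t Dt; apply: contrapT => nt; apply: (DE t); split=> // -[x Ex Bxt].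
    by apply: nt; exists x => //; right.
  - by split; [exact: zsetsT|exists setT, set0].
  - move=> P Q [ZP [D [E [AD Efin DP]]]] [ZQ [D' [E' [AD' E'fin DQ]]]].
    split; first exact: zsetsI.
    exists (D `&` D'), (E `|` E'); split; [exact: AI|by rewrite finite_setU|].
    move=> t [[Dt D't] nt]; split; [apply: DP|apply: DQ]; split=> // -[x Ex Bxt].
      by apply: nt; exists x => //; left.
    by apply: nt; exists x => //; right.
  - move=> P Q [ZP [D [E [AD Efin DP]]]] ZQ PQ; split=> //.
    by exists D, E; split=> //; exact: subset_trans PQ.
have [p pU qp] := zfilter_sub_zultrafilter qF; have [[_ _ _ pI _] _] := pU.
have [nu pnu] := zultrafilter_mean pU.
have Anu : fbar F A (toR nu).
  apply/fbarP; exists p; split=> //; last exact: (tends_gives pU.1 pnu).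
  move=> D AD; apply: qp; split; first exact: AZ.
  by exists D, set0; split=> // t [].
(* By minimality the orbit of [nu] is the whole ideal, so [x0] is a product [x * nu]. *)
have := Amin _ (left_ideal_orbit x0 (toR nu)).
move=> /(_ _)/seteqP[|_ /(_ _ Ax0)[x _ xnu]].
  by move=> _ [x _ <-]; exact: Aideal.
move: nZx0; rewrite -xnu -(ofRK x) Rmul_toR; set rho := ofR x.
move=> /(not_zbar_mean_null ZZ)[u [e [[[Fu rnu0] u0] e0 uZ]]].
have [r rU rrho] := gives_ex rho.
have e4 : 0 < e / 4 by rewrite divr_gt0.
(* Since [rho (T_nu u) = 0], some point [y] of [S] has [nu (L_y u)] within [e / 4] of 0. *)
have [y /=] := zfilter_nonempty rU.1
  (gives_tends rU rrho (Topelt nu (elt Fu)) e4).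
move: rnu0; rewrite {1}/mean_fun /= -/(mean_fun rho _) => ->; rewrite subr0 => nuy.
have Fuy : realF F (fun t => u (y * t)%g) by exact: isa_ltransl Fu.
(* If [u (y * t) < e] then [y * t] is outside [Z], hence in [B]; so this set contains the complement
   of the translate of [B] by [y]. *)
have py : p [set t | e <= u (y * t)%g].
  apply: qp; split; first exact: zsets_ge.
  exists setT, [set y]; split; [exact: AT|exact: finite_set1|].
  move=> t [_ nt] /=; rewrite leNgt; apply/negP => /ltW /uZ /nZB Byt.
  by apply: nt; exists y.
(* Along [p], [u (y * t)] tends to [nu (L_y u)], so some [t] has both [u (y * t) >= e] and
   [u (y * t) <= e / 2]. *)
have [t [et uyt]] := zfilter_nonempty pU.1
  (pI _ _ py (pnu (ltranslelt y (elt Fu)) _ e4)).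
have small a z : 0 <= a -> normc (a%:C - z) <= e / 4 -> normc z <= e / 4 -> a < e.
  move=> a0 az ze; have := normc_triangle (a%:C - z) z.
  by rewrite subrK normc_real ger0_norm//; lra.
by have := small _ _ (u0 (y * t)%g) uyt nuy; rewrite ltNge et.
Qed.

(* The orbit S^F nu is compact, so this is separation from a closed set; the
   ultrafilter argument yields it without a topology on S^F. *)
Lemma orbit_separation mu nu : (forall rho, mean_mul rho nu <> mu) ->
  exists u (Fu : realF F u) (e : R), [/\ mean_null mu u, 0 < e &
    forall s, e < normc (mean_fun nu (ltranslelt s (elt Fu)))].
Proof.
move=> munu; apply: contrapT => nosep.
(* Without separation the sublevel sets of the [T_nu u], for [u] null at [mu], are nonempty and
   generate a z-filter. *)
pose q := [set Q | zsets F Q /\ exists u (Fu : realF F u) (e : R),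
  [/\ mean_null mu u, 0 < e &
      [set s | normc (mean_fun nu (ltranslelt s (elt Fu))) <= e] `<=` Q]].
(* As these values are nonnegative reals, a small sum forces both summands to be small. *)
have ge0 u (Fu : realF F u) s : (forall t, 0 <= u t) -> exists2 r : R, 0 <= r &
    mean_fun nu (ltranslelt s (elt Fu)) = r%:C.
  move=> u0; have Fsu : realF F (fun t => u (s * t)%g) by exact: isa_ltransl Fu.
  have [r r0 nur] := mean_ge0 nu Fsu (fun t => u0 _).
  by exists r => //; rewrite -nur; congr mean_fun; exact: elt_inj.
have qF : zfilter F q.
  split.
  - by move=> Q [].
  - move=> [_ [u [Fu [e [mu_u e0 ue]]]]]; apply: nosep; exists u, Fu, e; split=> // s.
    by rewrite ltNge; apply/negP => /ue.
  - split; first exact: zsetsT.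
    have [[Fu _] _] := mean_null_sqr mu (celt F 0).
    by exists _, Fu, 1; split=> //; exact: (mean_null_sqr mu (celt F 0)).
  - move=> P Q [ZP [u [Fu [d [mu_u d0 uP]]]]] [ZQ [v [Fv [e [mu_v e0 vQ]]]]].
    split; first exact: zsetsI.
    exists _, (realFD Fu Fv), (Num.min d e).
    split; [exact: mean_nullD|by rewrite lt_min d0|].
    move=> s /=; have [a a0 ua] := ge0 _ Fu s mu_u.2.
    have [b b0 vb] := ge0 _ Fv s mu_v.2.
    have -> : mean_fun nu (ltranslelt s (elt (realFD Fu Fv))) = (a + b)%:C.
      transitivity (a%:C + b%:C); last by rewrite rmorphD.
      rewrite -ua -vb; have [<- _ _ _ _] := mean_funP nu.
      by congr mean_fun; apply: elt_inj => t; rewrite /eval /= /ltransl /eval /= rmorphD.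
    rewrite normc_real ger0_norm ?addr_ge0// le_min => /andP[abd abe].
    split; [apply: uP|apply: vQ]; rewrite /mkset ?ua ?vb normc_real ger0_norm//; lra.
  - move=> P Q [ZP [u [Fu [e [mu_u e0 uP]]]]] ZQ PQ; split=> //.
    by exists u, Fu, e; split=> //; exact: subset_trans PQ.
have [p pU qp] := zfilter_sub_zultrafilter qF.
have [rho prho] := zultrafilter_mean pU.
(* Along [p], [T_nu u] tends both to [(rho nu) u] and to 0, so [rho nu] vanishes wherever [mu] is
   null and equals [mu]. *)
apply: (munu rho); apply: mean_null_sub_eq => u mu_u; have [[Fu _] u0] := mu_u.
split=> //; exists Fu; apply: (tends_unique pU.1 (prho (Topelt nu (elt Fu)))) => e e0.
apply: qp; split; first by apply: zsets_normc_ball; [exact: evalP|exact: ltW].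
by exists u, Fu, e; split=> // s /=; rewrite subr0.
Qed.

Lemma syndetic_minimal_left_ideal (A : set (set S)) : zfilter F A ->
  left_ideal (fbar F A) ->
  (forall Z : set S, zsets F Z -> fbar F A `\` zbar F Z !=set0 ->
     forall B : set S, zsets F B ->
       zbar F setT `\` zbar F Z `<=` (zbar F B)° ->
       exists (C : set S) (E : set S), [/\ A C, finite_set E, E !=set0 &
         C `&` Z `<=` \bigcup_(x in E) ((fun t => x * t)%g @^-1` B)]) ->
  minimal_left_ideal (fbar F A).
Proof.
move=> hA hL syn; split=> // K [[y Ky] Kideal] KA; apply/seteqP; split=> // m Am.
apply: contrapT => nKm; have [_ _ AT _ _] := hA.
have [s0 _] := zfilter_nonempty hA AT.
pose mu := ofR m; pose nu := ofR y.
have [|u [Fu [e [mu_u e0 unu]]]] := @orbit_separation mu nu.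
  move=> rho rhonu; apply: nKm; rewrite -(ofRK m) -/mu -rhonu -Rmul_toR ofRK.
  exact: Kideal.
have e2 : 0 < e / 2 by rewrite divr_gt0.
have e4 : 0 < e / 4 by rewrite divr_gt0.
(* The level [e / 2] lies strictly between the value 0 at [mu] and the bound [e] on the orbit. [Z]
   and [B] cover [S], so the open complement of [zbar Z] lies in [zbar B]. *)
pose Z := [set s | e / 2 <= u s]; pose B := [set s | u s <= e / 2].
have ZZ : zsets F Z by exact: zsets_ge.
have ZB : zsets F B by exact: zsets_le.
have [||C [E [AC Efin _ CZB]]] := syn Z ZZ _ B ZB.
- exists m; split=> //; rewrite -(ofRK m) => /zbarP[p [pU pZ pmu]].
  have [[_ _ _ pI _] _] := pU.
  have [s []] := zfilter_nonempty pU.1 (pI _ _ pZ (gives_mean_null pU pmu mu_u e4)).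
  rewrite /Z /=; lra.
- rewrite zbarT setTD; rewrite -open_subsetE; last exact: open_zbarC.
  move=> x nZx; have : (zbar F (Z `|` B)) x.
    rewrite (_ : Z `|` B = setT) ?zbarT//.
    by apply/seteqP; split=> // s _ /=; apply/orP; exact: le_total.
  by rewrite zbarU// => -[].
(* The separation bounds [nu] only on translates of [u]; at [eps s0 * nu] the bound holds for [u]
   itself and, since [L_s0 (L_x u) = L_(x * s0) u], again for its translates. *)
have unu1 x : e < normc (mean_fun (mean_mul (eps F s0) nu) (ltranslelt x (elt Fu))).
  rewrite {1}/mean_fun /= /eval /= /Top.
  rewrite (_ : ltranslelt s0 _ = ltranslelt (x * s0)%g (elt Fu))//.
  by apply: elt_inj => t; rewrite /eval /= /ltransl /eval /= mulgA.
have /KA : K (toR (mean_mul (eps F s0) nu)).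
  by rewrite -Rmul_toR ofRK; exact: Kideal.
move=> /fbarP[p [pU Ap pnu]]; have [[_ _ _ pI pS] _] := pU.
have big a z : 0 <= a -> normc (a%:C - z) <= e / 4 -> e < normc z -> e / 2 < a.
  move=> a0; rewrite normcB => az ez; have := normc_triangle (z - a%:C) a%:C.
  by rewrite subrK normc_real ger0_norm//; lra.
have pZ : p Z.
  apply: (pS _ _ (gives_tends pU pnu (elt Fu) e4)) => // s us.
  by apply/ltW/(big _ _ _ us (unu s0)); exact: mu_u.2.
have ZBx x : zsets F ((fun t => x * t)%g @^-1` B) by exact: zsets_ltransl.
(* [p] contains [C] and [Z], hence one of the finitely many translates of [B]; there
   [u (x * t) <= e / 2], against a limit of modulus above [e]. *)
have [|x _ pBx] := zultrafilter_bigcup_finite pU Efin ZBx.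
  apply: (pS _ _ (pI _ _ (Ap _ AC) pZ) _ CZB); exact: zsets_bigcup_finite.
have [t [But uxt]] := zfilter_nonempty pU.1
  (pI _ _ pBx (gives_tends pU pnu (ltranslelt x (elt Fu)) e4)).
have := big _ _ (mu_u.2 (x * t)%g) uxt (unu1 x).
by rewrite ltNge => /negP; apply.
Qed.

End Semigroup.

Theorem theorem3p20 (R : realType) (S : semitopSemigroupType)
    (hS : hausdorff_space S) (F : m_admissible R S)
    (A : set (set S)) (hA : zfilter F A) (hpure : pure F A)
    (hL : left_ideal (fbar F A)) :
  [<-> minimal_left_ideal (fbar F A);
     forall Z : set S, zsets F Z -> fbar F A `\` zbar F Z !=set0 ->
       forall B : set S, zsets F B ->
         zbar F setT `\` zbar F Z `<=` (zbar F B)° ->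
         exists E : set S, [/\ finite_set E, E !=set0 &
           A (\bigcup_(x in E) ((fun t => x * t)%g @^-1` B))];
     forall Z : set S, zsets F Z -> fbar F A `\` zbar F Z !=set0 ->
       forall B : set S, zsets F B ->
         zbar F setT `\` zbar F Z `<=` (zbar F B)° ->
         exists (C : set S) (E : set S), [/\ A C, finite_set E, E !=set0 &
           C `&` Z `<=` \bigcup_(x in E) ((fun t => x * t)%g @^-1` B)]].
Proof.
tfae.
- by move=> Amin Z ZZ AZ B ZB; exact: (minimal_left_ideal_syndetic hA).
- move=> syn Z ZZ AZ B ZB ZBi; have [E [Efin E0 AE]] := syn Z ZZ AZ B ZB ZBi.
  (* [C] is the union of translates itself. *)
  by eexists; exists E; split; [exact: AE| | |move=> t []].
- exact: syndetic_minimal_left_ideal.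
Qed.
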